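(* Let $n \geq 3$, $m \geq 3$, and $G = K_m^n = K_m \square \cdots \square K_m$ ($n$ factors). Then \[ \frac{3m^n}{n(m-1)+3} \leq \gamma^{\mathrm{GID}}(G) \leq m^{n-1}. \]
   Context: $K_m^n$ is the Hamming graph with vertex set $\mathbb{Z}_m^n$, a group under componentwise addition modulo $m$, two vertices adjacent iff they differ in exactly one coordinate. For $C \subseteq V(G)$, $J_C(v) = N[v] \cap C$ with $N[v]$ the closed neighborhood. $C$ is an identifying code if the sets $J_C(v)$, $v \in V(G)$, are all nonempty and pairwise distinct; a group identifying code is an identifying code that is a subgroup of $V(G)$. $\gamma^{\mathrm{GID}}(G)$ is the minimum cardinality of a group identifying code in $G$. *)

(* Defs.v *)
From HB Require Import structures.
From mathcomp Require Import all_boot all_order all_algebra all_fingroup.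

Set Implicit Arguments.
Unset Strict Implicit.
Unset Printing Implicit Defensive.

Definition closed_nbhd (V : finType) (e : rel V) (v : V) : {set V} :=
  [set w | (w == v) || e v w].

Definition code_nbhd (V : finType) (e : rel V) (C : {set V}) (v : V) : {set V} :=
  closed_nbhd e v :&: C.

Definition identifying_code (V : finType) (e : rel V) (C : {set V}) : bool :=
  [forall v, code_nbhd e C v != set0] && injectiveb (code_nbhd e C).

(* The index #|V|.+1 of the iterated minimum exceeds the cardinality of every
   subset of V, hence is the value exactly when no group identifying code
   exists. *)
Definition gammaGID (V : finGroupType) (e : rel V) : nat :=
  \big[minn/#|V|.+1]_(C : {group V} | identifying_code e C) #|C|.

Lemma gammaGID_min (V : finGroupType) (e : rel V) (C : {group V}) :
  identifying_code e C -> gammaGID e <= #|C|.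
Proof.
move=> idC; rewrite /gammaGID.
elim: (index_enum _) (mem_index_enum C) => [//|D r IHr].
rewrite inE big_cons => /predU1P[<-|/IHr leC]; first by rewrite idC geq_minl.
by case: ifP => // _; rewrite geq_min leC orbT.
Qed.

Lemma gammaGID_attained (V : finGroupType) (e : rel V) :
  gammaGID e <= #|V| ->
  exists2 C : {group V}, identifying_code e C & #|C| = gammaGID e.
Proof.
suff [-> | //] : gammaGID e = #|V|.+1 \/
    exists2 C : {group V}, identifying_code e C & #|C| = gammaGID e.
  by rewrite ltnn.
rewrite /gammaGID.
elim/big_ind: _ => [|x y Hx Hy|C idC]; first by left.
  by rewrite /minn; case: ifP.
by right; exists C.
Qed.

(* The finGroupType structure of 'rV['Z_m]_n is the additive one. Since 'Z_m is
   the integers mod m only for m > 1, this is K_m^n only for m > 1. *)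
Definition hamming_adj (m n : nat) : rel 'rV['Z_m]_n :=
  fun u v => #|[set i | u ord0 i != v ord0 i]| == 1.

Lemma hamming_mulgE (m n : nat) (u v : 'rV['Z_m]_n) : (u * v)%g = (u + v)%R.
Proof. by []. Qed.

(* Main.v *)
Require Import Defs.
From HB Require Import structures.
From mathcomp Require Import all_boot all_order all_algebra all_fingroup.
From mathcomp Require Import zify ring.

Set Implicit Arguments.
Unset Strict Implicit.
Unset Printing Implicit Defensive.

Import GRing.Theory Num.Theory.
Local Open Scope ring_scope.

(** Upper bound: the subgroup of vectors of zero coordinate sum is identifying.

Lower bound: count the pairs (v, c) with c in J_C(v). An identifying code has at
most |C| vertices with |J_C(v)| = 1, and a group identifying code has none with
|J_C(v)| = 2. Indeed, if J_C(v) = {a, b}, the symmetry x |-> a + b - x preserves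
C and {a, b}, hence fixes v, so that a = v + x e_i and b = v - x e_i. With
d = a - b in C, the codeword a + d = v + 3x e_i lies in J_C(v), so it is b and
2d = 0; then J_C(v + d) = J_C(v) + d = J_C(v), contradicting d <> 0. *)

(** * Counting code neighbourhoods in an arbitrary finite graph *)

Section IdentifyingCode.
Variables (V : finType) (e : rel V).

(** Double counting of the pairs [(v, c)] with [c] in [C] adjacent or equal to [v]; symmetry of [e]
    lets the pairs be counted from [c]. *)
Lemma sum_card_code_nbhd (C : {set V}) : symmetric e ->
  (\sum_v #|code_nbhd e C v| = \sum_(c in C) #|closed_nbhd e c|)%N.
Proof.
move=> e_sym.
transitivity (\sum_v \sum_(c in C | c \in closed_nbhd e v) 1)%N.
  apply: eq_bigr => v _; rewrite sum1_card; apply: eq_card => c.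
  by rewrite [RHS]unfold_in /= !inE andbC.
rewrite (exchange_big_dep (mem C)) => [|v c _ /andP[]//]; apply: eq_bigr => c cC.
rewrite sum1_card; apply: eq_card => v.
by rewrite unfold_in /= !inE [c \in C]cC eq_sym e_sym.
Qed.

Lemma code_nbhd_inj (C : {set V}) :
  identifying_code e C -> injective (code_nbhd e C).
Proof. by case/andP=> _ /injectiveP. Qed.

(** [code_nbhd e C] maps these vertices injectively to singletons of codewords. *)
Lemma card_code_nbhd1 (C : {set V}) : identifying_code e C ->
  (#|[set v | #|code_nbhd e C v| == 1] | <= #|C|)%N.
Proof.
move=> idC; rewrite -(card_imset _ (code_nbhd_inj idC)).
rewrite -(card_imset (mem C) (@set1_inj V)).
apply/subset_leq_card/subsetP=> _ /imsetP[v + ->]; rewrite inE => /cards1P[c Jc].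
apply/imsetP; exists c => //.
by have := set11 c; rewrite -Jc => /setIP[].
Qed.

End IdentifyingCode.

(** * Symmetries of the Hamming graph and the lower bound *)

Section Hamming.
Variables (m n : nat).
Implicit Types (u v w : 'rV['Z_m]_n) (C : {group 'rV['Z_m]_n}).
Local Notation e := (@hamming_adj m n).

Lemma hamming_adj_sym : symmetric e.
Proof.
move=> u v; rewrite /hamming_adj; congr (_ == _).
by apply: eq_card => i; rewrite !inE eq_sym.
Qed.

Lemma addrow_deltaE v (i j : 'I_n) x :
  (v + x *: delta_mx 0 i) 0 j = v 0 j + x *+ (j == i).
Proof. by rewrite !mxE eqxx /= mulr_natr. Qed.

Lemma closed_nbhd_hammingP v w :
  reflect (w = v \/ exists i x, x != 0 /\ w = v + x *: delta_mx 0 i)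
          (w \in closed_nbhd e v).
Proof.
rewrite inE; apply: (iffP orP) => [[/eqP->|]|[->|[i [x [x0 ->]]]]]; first by left.
- case/cards1P=> i D; right; exists i, (w 0 i - v 0 i); split.
    by rewrite subr_eq0 eq_sym; have := set11 i; rewrite -D inE.
  apply/rowP=> j; rewrite addrow_deltaE; have [->|ji] := eqVneq j i.
    by rewrite addrC subrK.
  rewrite addr0; have := in_set1 j i.
  by rewrite -D inE (negPf ji) => /negbFE/eqP/esym.
- by left.
- right; apply/cards1P; exists i; apply/setP=> j; rewrite !inE addrow_deltaE.
  have [->|_] := eqVneq j i; last by rewrite addr0 eqxx.
  by rewrite -[X in X != _]addr0 (inj_eq (addrI _)) eq_sym.
Qed.

Lemma line_closed_nbhd v i x : v + x *: delta_mx 0 i \in closed_nbhd e v.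
Proof.
apply/closed_nbhd_hammingP; have [->|x0] := eqVneq x 0.
  by left; rewrite scale0r addr0.
by right; exists i, x.
Qed.

(** The reflection [x |-> s - x] is a graph automorphism; as it is an involution, one implication
    suffices. *)
Lemma closed_nbhd_reflect (s u v : 'rV['Z_m]_n) :
  (u \in closed_nbhd e (s - v)) = (s - u \in closed_nbhd e v).
Proof.
suff imp a b : a \in closed_nbhd e (s - b) -> s - a \in closed_nbhd e b.
  apply/idP/idP=> [|h]; first exact: imp.
  by have := imp (s - u) (s - v); rewrite !subKr; apply.
case/closed_nbhd_hammingP=> [->|[i [x [_ ->]]]].
  by rewrite subKr inE eqxx.
by rewrite opprD addrA subKr -scaleNr line_closed_nbhd.
Qed.

Lemma card_closed_nbhd_hamming v : (1 < m)%N ->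
  (#|closed_nbhd e v| <= n * m.-1 + 1)%N.
Proof.
move=> m_gt1.
pose f (p : 'I_n * 'Z_m) := v + p.2 *: delta_mx 0 p.1.
have sub : closed_nbhd e v \subset v |: f @: setX setT [set~ 0].
  apply/subsetP=> w /closed_nbhd_hammingP[->|[i [x [x0 ->]]]].
    by rewrite setU11.
  by apply/setUP; right; apply/imsetP; exists (i, x); rewrite // !inE.
apply: leq_trans (subset_leq_card sub) _.
apply: leq_trans (leq_card_setU _ _) _; rewrite cards1 addnC leq_add2r.
apply: leq_trans (leq_imset_card _ _) _.
by rewrite cardsX cardsT cardsC1 !card_ord Zp_cast.
Qed.

Lemma code_nbhd_reflect C (s v : 'rV['Z_m]_n) : s \in C ->
  code_nbhd e C (s - v) = [set u | s - u \in code_nbhd e C v].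
Proof.
move=> sC; apply/setP=> u; rewrite [RHS]in_set !in_setI closed_nbhd_reflect.
congr andb; rewrite -[s - u]/(s * u^-1)%g groupMl //.
by rewrite groupV.
Qed.

(** Translation by [s] is the reflection [x |-> 0 - x] followed by [x |-> s - x]. *)
Lemma code_nbhd_add C (s v : 'rV['Z_m]_n) : s \in C ->
  code_nbhd e C (v + s) = [set u | u - s \in code_nbhd e C v].
Proof.
move=> sC; rewrite -[v in LHS]opprK -[- v]sub0r addrC code_nbhd_reflect //.
rewrite code_nbhd_reflect ?group1 //; apply/setP=> u; rewrite !in_set.
by rewrite sub0r opprB.
Qed.

Lemma card_code_nbhd_neq2 C v : identifying_code e C ->
  #|code_nbhd e C v| != 2.
Proof.
move=> idC; apply/negP=> /cards2P[a [b [ab Jv]]].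
have [aJ bJ] : a \in code_nbhd e C v /\ b \in code_nbhd e C v.
  by rewrite Jv !inE !eqxx orbT.
have [[aN aC] [bN bC]] := (setIP aJ, setIP bJ).
have JI := code_nbhd_inj idC.
have abv : a + b - v = v.
  apply: JI; rewrite code_nbhd_reflect ?(groupM aC bC) // Jv; apply/setP=> u.
  rewrite !inE !subr_eq [a + b == a + u](inj_eq (addrI a)) addrC.
  by rewrite (inj_eq (addrI b)) orbC [u == a]eq_sym [u == b]eq_sym.
have d0 : a - b != 0 by rewrite subr_eq0.
have dC : a - b \in C by rewrite -[a - b]/(a * b^-1)%g groupM ?groupV.
have bE : b = v + v - a by rewrite -{1}abv subrK addrAC subrr add0r.
have adN : a + (a - b) \in closed_nbhd e v.
  case/closed_nbhd_hammingP: aN => [av|[i [x [_ aE]]]].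
    by case/eqP: ab; rewrite bE av addrK.
  have -> : a + (a - b) = v + (x *+ 3) *: delta_mx 0 i.
    by rewrite bE aE; apply/rowP=> j; rewrite !mxE; ring.
  exact: line_closed_nbhd.
have : a + (a - b) \in code_nbhd e C v.
  by rewrite in_setI adN -[_ + _]/(a * (a - b))%g groupM.
rewrite Jv !inE -[X in _ == X]addr0 (inj_eq (addrI a)) (negPf d0) /= => /eqP dd.
(* By [dd], translation by [a - b] swaps [a] and [b], so [v + (a - b)] and [v] have the same code
   neighbourhood. *)
case/eqP: d0; apply: (@addrI _ v); rewrite addr0; apply: JI.
rewrite code_nbhd_add // Jv; apply/setP=> u; rewrite !inE !subr_eq dd orbC.
by rewrite [b + _]addrC subrK.
Qed.

Lemma group_identifying_code_bound C : (1 < m)%N -> identifying_code e C ->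
  (3 * m ^ n <= #|C| * (n * m.-1 + 3))%N.
Proof.
move=> m_gt1 idC; pose S := [set v | #|code_nbhd e C v| == 1%N].
have cardV : #|{: 'rV['Z_m]_n}| = (m ^ n)%N.
  by rewrite card_mx card_ord Zp_cast // mul1n.
(* Sizes 0 and 2 are excluded, and the extra 2 on [S] makes up for size 1. *)
have J3 v : (3 <= #|code_nbhd e C v| + 2 * (v \in S))%N.
  have := card_code_nbhd_neq2 v idC.
  have := forallP (proj1 (andP idC)) v.
  by rewrite inE -card_gt0; case: #|_| => [|[|[|k]]].
have : (\sum_(v : 'rV['Z_m]_n) 3
         <= \sum_v (#|code_nbhd e C v| + 2 * (v \in S)))%N.
  exact: leq_sum.
rewrite sum_nat_const cardV mulnC => /leq_trans; apply.
rewrite big_split /= (sum_card_code_nbhd _ hamming_adj_sym) -big_distrr /=.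
rewrite -(big_mkcond (mem S)) /= sum1_card.
have leN : (\sum_(c in C) #|closed_nbhd e c| <= #|C| * (n * m.-1 + 1))%N.
  rewrite -sum_nat_const; apply: leq_sum => c _.
  exact: card_closed_nbhd_hamming.
(* Per codeword, [n * m.-1 + 1] pays for the neighbourhoods and 2 for [S]. *)
rewrite -[3%N]/(1 + 2)%N addnA mulnDr leq_add // mulnC leq_mul2r orFb.
exact: card_code_nbhd1.
Qed.

End Hamming.

(** * The zero-sum code and the upper bound *)

Section ZeroSumCode.
Variables (m n : nat).
Implicit Types u v w : 'rV['Z_m]_n.

Definition zero_sum : {set 'rV['Z_m]_n} := 
  [set v : 'rV['Z_m]_n | \sum_i v 0 i == 0].

Lemma zero_sum_group_set : group_set zero_sum.
Proof.
apply/group_setP; split=> [|u v].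
  by rewrite inE big1 // => i _; rewrite mxE.
rewrite !inE => /eqP u0 /eqP v0.
under eq_bigr do rewrite hamming_mulgE mxE.
by rewrite big_split /= u0 v0 addr0.
Qed.

Canonical zero_sum_group := Group zero_sum_group_set.

Lemma sum_addrow_delta v (i : 'I_n) x :
  \sum_j (v + x *: delta_mx 0 i) 0 j = \sum_j v 0 j + x.
Proof.
under eq_bigr do rewrite addrow_deltaE.
rewrite big_split /=; congr (_ + _).
by rewrite (bigD1 i) //= eqxx big1 ?addr0 // => j /negPf->.
Qed.

(** Correcting coordinate [i] alone makes the sum vanish, so every line through [v] meets the
    code. *)
Lemma zero_sum_line v i :
  v - (\sum_j v 0 j) *: delta_mx 0 i
    \in code_nbhd (@hamming_adj m n) zero_sum v.
Proof.
by rewrite in_setI -scaleNr line_closed_nbhd inE sum_addrow_delta subrr.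
Qed.

Lemma zero_sum_identifying : (3 <= n)%N ->
  identifying_code (@hamming_adj m n) zero_sum.
Proof.
move=> n3; pose J := code_nbhd (@hamming_adj m n) zero_sum.
apply/andP; split.
  apply/forallP=> v; apply/set0Pn.
  by eexists; apply: (zero_sum_line v (Ordinal (ltnW (ltnW n3)))).
pose s v := \sum_j v 0 j.
(* If v and w differ at k, then w - s(w) e_i and w - s(w) e_j with i, j <> k
   both differ from v at k, hence only there, so they coincide. *)
have key v w : J v = J w -> s w != 0 -> v = w.
  move=> Jvw sw0; apply/eqP; apply/negPn/negP=> /eqP vw.
  have [k vwk] : exists k, v 0 k != w 0 k.
    apply/existsP; apply: contraT => /existsPn vwE; case: vw.
    by apply/rowP=> k; apply/eqP; have := vwE k; rewrite negbK.
  (* [n >= 3] leaves two coordinates besides [k]. *)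
  have [i [j [ij ik jk]]] : exists i j : 'I_n, [/\ i != j, i != k & j != k].
    have : (1 < #|[set~ k]|)%N by rewrite cardsC1 card_ord; lia.
    by case/card_gt1P=> i [j [+ + ij]]; rewrite !inE; exists i, j.
  have off l : l != k -> exists x, w - s w *: delta_mx 0 l = v + x *: delta_mx 0 k.
    move=> lk; have : w - s w *: delta_mx 0 l \in J v by rewrite Jvw zero_sum_line.
    case/setIP=> /closed_nbhd_hammingP + _.
    rewrite -scaleNr; case=> [E|[h [x [_ E]]]].
      case/eqP: vwk; move/rowP/(_ k): E; rewrite addrow_deltaE.
      by rewrite eq_sym (negPf lk) addr0.
    suff <- : h = k by exists x.
    apply/eqP; apply: contraNT vwk => hk; move/rowP/(_ k): E.
    by rewrite !addrow_deltaE ![k == _]eq_sym (negPf lk) (negPf hk) !addr0 => ->.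
  have [x Ei] := off i ik; have [y Ej] := off j jk.
  (* At coordinate [i], [Ej] gives [v 0 i = w 0 i] while [Ei] gives [v 0 i = w 0 i - s w], so [s w]
     would be 0. *)
  move/rowP/(_ i): Ei; move/rowP/(_ i): Ej; rewrite -!scaleNr !addrow_deltaE.
  rewrite eqxx (negPf ij) (negPf ik) !addr0 => <- /eqP.
  by rewrite -[X in _ == X]addr0 (inj_eq (addrI _)) oppr_eq0 (negPf sw0).
apply/injectiveP=> v w Jvw.
have [sw|sw] := eqVneq (s w) 0; last exact: key.
have [sv|sv] := eqVneq (s v) 0; last by apply/esym/key.
have i := Ordinal (ltnW (ltnW n3)).
(* Now both are codewords. As [v] lies in [J v = J w], it is [w] or differs from it in one
   coordinate, which would change the sum. *)
have : v \in J w.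
  rewrite -[J w]Jvw; have := zero_sum_line v i.
  by rewrite -/(s v) sv scale0r subr0.
case/setIP=> /closed_nbhd_hammingP[//|[k [x [x0 vE]]]] _.
case/eqP: x0; move: sv; rewrite /s vE.
by rewrite sum_addrow_delta -/(s w) sw add0r.
Qed.

End ZeroSumCode.

(** Dropping coordinate 0 is injective on the code, since that coordinate is minus the sum of the
    others. *)
Lemma card_zero_sum m n : (1 < m)%N -> (#|zero_sum m n.+1| <= m ^ n)%N.
Proof.
move=> m_gt1.
pose f (v : 'rV['Z_m]_n.+1) : 'rV['Z_m]_n := \row_j v 0 (lift ord0 j).
have f_inj : {in zero_sum m n.+1 &, injective f}.
  move=> u v; rewrite !inE !big_ord_recl !addr_eq0 => /eqP u0 /eqP v0 /rowP fuv.
  have uv j : u 0 (lift ord0 j) = v 0 (lift ord0 j).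
    by have := fuv j; rewrite !mxE.
  apply/rowP=> i; case: (unliftP ord0 i) => [j|] ->; first exact: uv.
  by rewrite u0 v0; congr (- _); apply: eq_bigr.
rewrite -(card_in_imset f_inj); apply: leq_trans (max_card _) _.
by rewrite card_mx card_ord Zp_cast // mul1n.
Qed.

Theorem theorem3p10 (n m : nat) (hn : (3 <= n)%N) (hm : (3 <= m)%N) :
  (3 * m%:R ^+ n / (n%:R * (m%:R - 1) + 3) : rat)
    <= (gammaGID (@hamming_adj m n))%:R
  /\ (gammaGID (@hamming_adj m n) <= m ^ (n - 1))%N.
Proof.
have m_gt1 : (1 < m)%N by apply: ltnW.
have upper : (gammaGID (@hamming_adj m n) <= m ^ (n - 1))%N.
  have idZ := zero_sum_identifying m hn.
  apply: leq_trans (@gammaGID_min _ _ (zero_sum_group m n) idZ) _.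
  by case: n hn {idZ} => // k _; rewrite subn1 card_zero_sum.
split=> //.
(* The upper bound rules out the default value [#|V|.+1], so some code attains the minimum. *)
have [|C idC <-] := @gammaGID_attained _ (@hamming_adj m n).
  apply: leq_trans upper _; rewrite card_mx card_ord Zp_cast // mul1n.
  by rewrite leq_exp2l // leq_subr.
have den : (n%:R * (m%:R - 1) + 3 : rat) = (n * m.-1 + 3)%:R.
  by rewrite natrD natrM -subn1 natrB // ltnW.
rewrite den ler_pdivrMr ?ltr0n ?addn_gt0 ?orbT //.
by rewrite -natrX -!natrM ler_nat group_identifying_code_bound.
Qed.
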